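(* Let $R$ be a commutative Noetherian ring with $1$ such that $\dim \operatorname{Max} R = d$, let $n$ be a non-negative integer, and let $A$ be a finite $R$-algebra. Suppose that for every $\mathfrak{p} \in \operatorname{Max} R$ the algebra $A(\mathfrak{p})$ can be generated by $n$ elements as a non-unital $R(\mathfrak{p})$-algebra. Then $A$ can be generated by $n+d$ elements as a non-unital $R$-algebra.
   Context: A finite $R$-algebra is a finitely generated $R$-module $A$ together with an arbitrary $R$-bilinear multiplication map $A \times A \to A$; it is not assumed to be commutative, associative, or to have a unit element. For $\mathfrak{p} \in \operatorname{Spec} R$, $R(\mathfrak{p})$ denotes the fraction field of $R/\mathfrak{p}$ (so $R(\mathfrak{p}) = R/\mathfrak{p}$ when $\mathfrak{p}$ is maximal), and $A(\mathfrak{p}) := A \otimes_R R(\mathfrak{p})$ with the induced $R(\mathfrak{p})$-algebra structure. A set of elements generates an algebra over a commutative ring as a non-unital algebra if the smallest submodule closed under multiplication and containing these elements is the whole algebra. ''Generated by $m$ elements'' means that there exist $m$ (not necessarily distinct) elements that generate. $\operatorname{Max} R$ is the set of maximal ideals with the subspace topology from $\operatorname{Spec} R$ (Zariski topology). The dimension of a topological space $X$ is the maximal length $d$ of a chain $\emptyset \neq X_0 \subsetneq X_1 \subsetneq \dots \subsetneq X_d \subseteq X$ of closed irreducible subsets; here $d$ is a (finite) non-negative integer. *)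

(* Defs.v *)
From HB Require Import structures.
From mathcomp Require Import all_boot all_order all_algebra.
From mathcomp Require Import generic_quotient ring_quotient fraction sesquilinear.
From mathcomp Require Import boolp classical_sets topology.

Set Implicit Arguments.
Unset Strict Implicit.
Unset Printing Implicit Defensive.

Import GRing.Theory.

Local Open Scope classical_set_scope.
Local Open Scope ring_scope.
Local Open Scope quotient_scope.

Definition finitely_generated (R : comNzRingType) (M : lmodType R)
    (N : set M) : Prop :=
  exists (m : nat) (g : 'I_m -> M),
    N = range (fun c : 'I_m -> R => \sum_i c i *: g i).

(* The ideals of R are the submodules of the regular module R^o. *)
Definition noetherian (R : comNzRingType) : Prop :=
  forall I : set R^o, submod_closed [in I] -> finitely_generated I.

Definition Spec (R : comNzRingType) : Type := prime_idealr R.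

HB.instance Definition _ R := gen_eqMixin (Spec R).
HB.instance Definition _ R := gen_choiceMixin (Spec R).

Section Zariski.
Variable R : comNzRingType.

Definition zero_locus (S : set R) : set (Spec R) :=
  [set p | forall x, S x -> x \in p].

Definition zariski_open (U : set (Spec R)) : Prop :=
  exists S : set R, U = ~` zero_locus S.

Lemma zariski_openT : zariski_open setT.
Proof.
exists [set 1]; apply/seteqP; split=> [p _ /(_ 1 erefl)|//].
by rewrite idealr1.
Qed.

Lemma zariski_openI : setI_closed zariski_open.
Proof.
move=> _ _ [S ->] [T ->].
exists [set z | exists x y, [/\ S x, T y & z = x * y]].
rewrite -setCU; congr (~` _); apply/seteqP; split=> p.
  move=> pST _ [x [y [Sx Ty ->]]].
  by case: pST => [/(_ x Sx)|/(_ y Ty)] pz; [rewrite mulrC|]; apply: idealMr.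
move=> pST; have [pS|] := pselect (zero_locus S p); first by left.
move=> /existsNP[x /not_implyP[Sx xNp]]; right=> y Ty.
have : x * y \in p by apply: pST; exists x, y.
by rewrite prime_idealrM => /orP[].
Qed.

Lemma zariski_open_bigU (I : Type) (f : I -> set (Spec R)) :
  (forall i, zariski_open (f i)) -> zariski_open (\bigcup_i f i).
Proof.
move=> /choice[S fS]; exists (\bigcup_i S i).
under eq_bigcupr do rewrite fS.
rewrite -setC_bigcap; congr (~` _); apply/seteqP; split=> p.
  by move=> pS x [i _ Six]; exact: pS Six.
by move=> pS i _ x Six; apply: pS; exists i.
Qed.

HB.instance Definition _ := isOpenTopological.Build (Spec R)
  zariski_openT zariski_openI zariski_open_bigU.

Definition maximal_point (p : Spec R) : Prop :=
  forall I : idealr R, {subset p <= I} -> {subset I <= p}.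

(* A set coerced to a type carries the subspace topology. *)
Definition MaxSpec : topologicalType := set_type [set p | maximal_point p].

End Zariski.

Section Dimension.
Variable T : topologicalType.

Definition irreducible (X : set T) : Prop :=
  X !=set0 /\
  forall F G, closed F -> closed G -> X `<=` F `|` G -> X `<=` F \/ X `<=` G.

Definition irreducible_chain (k : nat) (X : nat -> set T) : Prop :=
  (forall i, (i <= k)%N -> closed (X i) /\ irreducible (X i)) /\
  (forall i, (i < k)%N -> X i `<` X i.+1).

Definition has_dimension (d : nat) : Prop :=
  (exists X, irreducible_chain d X) /\
  (forall k X, irreducible_chain k X -> (k <= d)%N).

End Dimension.

Definition residue_ring (R : comNzRingType) (p : Spec R) : Type :=
  {ideal_quot p}.

Section ResidueRing.
Variables (R : comNzRingType) (p : Spec R).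
Local Notation Rp := (residue_ring p).

HB.instance Definition _ := GRing.ComNzRing.on Rp.

Definition residue_unit : pred Rp := fun x => `[< exists y, y * x = 1 >].
Definition residue_inv (x : Rp) : Rp :=
  if pselect (exists y, y * x = 1) is left e then projT1 (cid e) else x.

Lemma residue_mulVr : {in residue_unit, left_inverse 1 residue_inv *%R}.
Proof.
move=> x /asboolP ux; rewrite /residue_inv.
by case: pselect => // e; case: cid.
Qed.

Lemma residue_unitP (x y : Rp) : y * x = 1 -> residue_unit x.
Proof. by move=> yx; apply/asboolP; exists y. Qed.

Lemma residue_inv_out : {in [predC residue_unit], residue_inv =1 id}.
Proof.
move=> x /asboolPn Nux; rewrite /residue_inv.
by case: pselect => // e; case: Nux.
Qed.

HB.instance Definition _ := GRing.ComNzRing_hasMulInverse.Build Rp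
  residue_mulVr residue_unitP residue_inv_out.

Lemma residue_integral (x y : Rp) : x * y = 0 -> (x == 0) || (y == 0).
Proof. exact: (@Quotient.rquot_IdomainAxiom R p). Qed.

HB.instance Definition _ :=
  GRing.ComUnitRing_isIntegral.Build Rp residue_integral.

Definition residue_field : fieldType := {fraction Rp}.

Definition to_residue_field (r : R) : residue_field :=
  tofrac (\pi_({ideal_quot p}) r : Rp).

Lemma to_residue_field_zmod : zmod_morphism to_residue_field.
Proof.
move=> x y; rewrite /to_residue_field -tofracB; congr tofrac.
exact: (rmorphB (\pi_({ideal_quot p}))).
Qed.

Lemma to_residue_field_monoid : monoid_morphism to_residue_field.
Proof.
split=> [|x y]; rewrite /to_residue_field.
  rewrite -tofrac1; congr tofrac; exact: (rmorph1 (\pi_({ideal_quot p}))).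
rewrite -tofracM; congr tofrac; exact: (rmorphM (\pi_({ideal_quot p}))).
Qed.

HB.instance Definition _ :=
  GRing.isZmodMorphism.Build R residue_field to_residue_field
    to_residue_field_zmod.
HB.instance Definition _ :=
  GRing.isMonoidMorphism.Build R residue_field to_residue_field
    to_residue_field_monoid.

End ResidueRing.

(* base_change phi A is the S-module A ⊗_R S, for S an R-algebra via phi.  A
   sequence of pairs (a, k) stands for the formal sum of the a ⊗ k, and
   tensor_rel is the congruence generated by R-balanced biadditivity.  Formal
   sums only form a monoid, so 0 ⊗ k = 0 has to be imposed; the opposite of
   a ⊗ k is then (- a) ⊗ k. *)
Section BaseChange.
Variables (R S : comNzRingType) (phi : {rmorphism R -> S}) (A : lmodType R).
Local Notation formal := (seq (A * S)).

Inductive tensor_rel : formal -> formal -> Prop :=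
| Tensor_refl s : tensor_rel s s
| Tensor_sym s t : tensor_rel s t -> tensor_rel t s
| Tensor_trans s t u : tensor_rel s t -> tensor_rel t u -> tensor_rel s u
| Tensor_cat s s' t t' :
    tensor_rel s s' -> tensor_rel t t' -> tensor_rel (s ++ t) (s' ++ t')
| Tensor_comm s t : tensor_rel (s ++ t) (t ++ s)
| Tensor_0l k : tensor_rel [:: (0, k)] [::]
| Tensor_addl a b k : tensor_rel [:: (a + b, k)] [:: (a, k); (b, k)]
| Tensor_addr a k l : tensor_rel [:: (a, k + l)] [:: (a, k); (a, l)]
| Tensor_balanced r a k : tensor_rel [:: (r *: a, k)] [:: (a, phi r * k)].

Definition tensor_relb : rel formal := fun s t => `[< tensor_rel s t >].

Lemma tensor_relb_equiv : equiv_class_of tensor_relb.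
Proof.
split=> [s|s t|t s u]; first exact/asboolP/Tensor_refl.
  by apply/asboolP/asboolP; exact: Tensor_sym.
by move=> /asboolP st /asboolP tu; apply/asboolP; exact: Tensor_trans st tu.
Qed.
Canonical tensor_relb_equivRel := EquivRelPack tensor_relb_equiv.
Canonical tensor_relb_encModRel := defaultEncModRel tensor_relb.

Definition base_change : Type := {eq_quot tensor_relb}.
HB.instance Definition _ := Choice.on base_change.
HB.instance Definition _ : EqQuotient formal tensor_relb base_change :=
  EqQuotient.on base_change.

Local Notation B := base_change.
Local Notation cls := (\pi_B : formal -> B).

Lemma base_changeP (s t : formal) : cls s = cls t <-> tensor_rel s t.
Proof.
by split=> [/eqmodP/asboolP//|st]; apply/eqmodP/asboolP.
Qed.

Lemma repr_base_change (s : formal) : tensor_rel (repr (cls s)) s.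
Proof. by apply/base_changeP; rewrite reprK. Qed.

Lemma base_changeW (P : B -> Prop) : (forall s, P (cls s)) -> forall x, P x.
Proof. by move=> Pcls x; rewrite -[x]reprK; exact: Pcls. Qed.

Definition opp_pair (x : A * S) : A * S := (- x.1, x.2).
Definition scale_pair (c : S) (x : A * S) : A * S := (x.1, c * x.2).

Definition bc_add (x y : B) : B := cls (repr x ++ repr y).
Definition bc_opp (x : B) : B := cls (map opp_pair (repr x)).
Definition bc_zero : B := cls [::].
Definition bc_scale (c : S) (x : B) : B := cls (map (scale_pair c) (repr x)).

Lemma tensor_rel_opp (s t : formal) :
  tensor_rel s t -> tensor_rel (map opp_pair s) (map opp_pair t).
Proof.
elim=> {s t} [s|s t _|s t u _ st _|s s' t t' _ ss' _ tt'|s t|k|a b k|a k l|r a k].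
- exact: Tensor_refl.
- exact: Tensor_sym.
- exact: Tensor_trans.
- by rewrite !map_cat; exact: Tensor_cat.
- by rewrite !map_cat; exact: Tensor_comm.
- by rewrite /opp_pair /= oppr0; exact: Tensor_0l.
- by rewrite /opp_pair /= opprD; exact: Tensor_addl.
- exact: Tensor_addr.
- by rewrite /opp_pair /= -scalerN; exact: Tensor_balanced.
Qed.

Lemma tensor_rel_scale (c : S) (s t : formal) :
  tensor_rel s t -> tensor_rel (map (scale_pair c) s) (map (scale_pair c) t).
Proof.
elim=> {s t} [s|s t _|s t u _ st _|s s' t t' _ ss' _ tt'|s t|k|a b k|a k l|r a k].
- exact: Tensor_refl.
- exact: Tensor_sym.
- exact: Tensor_trans.
- by rewrite !map_cat; exact: Tensor_cat.
- by rewrite !map_cat; exact: Tensor_comm.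
- exact: Tensor_0l.
- exact: Tensor_addl.
- by rewrite /scale_pair /= mulrDr; exact: Tensor_addr.
- by rewrite /scale_pair /= mulrCA; exact: Tensor_balanced.
Qed.

Lemma bc_addE (s t : formal) : bc_add (cls s) (cls t) = cls (s ++ t).
Proof. by apply/base_changeP/Tensor_cat; exact: repr_base_change. Qed.

Lemma bc_oppE (s : formal) : bc_opp (cls s) = cls (map opp_pair s).
Proof. exact/base_changeP/tensor_rel_opp/repr_base_change. Qed.

Lemma bc_scaleE (c : S) (s : formal) :
  bc_scale c (cls s) = cls (map (scale_pair c) s).
Proof. exact/base_changeP/tensor_rel_scale/repr_base_change. Qed.

Lemma bc_addA : associative bc_add.
Proof.
elim/base_changeW=> s; elim/base_changeW=> t; elim/base_changeW=> u.
by rewrite !bc_addE catA.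
Qed.

Lemma bc_addC : commutative bc_add.
Proof. by move=> x y; apply/base_changeP; exact: Tensor_comm. Qed.

Lemma bc_add0 : left_id bc_zero bc_add.
Proof. by elim/base_changeW=> s; rewrite bc_addE. Qed.

Lemma bc_addN : left_inverse bc_zero bc_opp bc_add.
Proof.
elim/base_changeW=> s; rewrite bc_oppE bc_addE; apply/base_changeP.
elim: s => [|x s IHs]; first exact: Tensor_refl.
have swap : tensor_rel (map opp_pair (x :: s) ++ x :: s)
    ([:: opp_pair x; x] ++ (map opp_pair s ++ s)).
  rewrite -[map _ (x :: s)]/([:: opp_pair x] ++ map opp_pair s) -[x :: s]cat1s.
  rewrite -[[:: _; x]]/([:: opp_pair x] ++ [:: x]) -!catA.
  apply: Tensor_cat; first exact: Tensor_refl.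
  rewrite !catA; apply: Tensor_cat; first exact: Tensor_comm.
  exact: Tensor_refl.
apply: Tensor_trans swap _.
rewrite -[X in tensor_rel _ X]cat0s; apply: Tensor_cat IHs.
case: x => a k; apply: Tensor_trans (Tensor_sym (Tensor_addl _ _ _)) _.
by rewrite addNr; exact: Tensor_0l.
Qed.

HB.instance Definition _ :=
  GRing.isZmodule.Build base_change bc_addA bc_addC bc_add0 bc_addN.

Lemma cls_cat (s t : formal) : cls (s ++ t) = cls s + cls t.
Proof. by rewrite -bc_addE. Qed.

Lemma cls_cons (x : A * S) (s : formal) : cls (x :: s) = cls [:: x] + cls s.
Proof. by rewrite -cls_cat. Qed.

Lemma cls_map_add (f g h : A * S -> A * S) (s : formal) :
  (forall x, cls [:: f x] = cls [:: g x] + cls [:: h x]) ->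
  cls (map f s) = cls (map g s) + cls (map h s).
Proof.
move=> fgh; elim: s => [|x s IHs] /=; first by rewrite [RHS]bc_add0.
rewrite cls_cons [cls (g x :: _)]cls_cons [cls (h x :: _)]cls_cons fgh IHs.
by rewrite addrACA.
Qed.

Lemma bc_scaleA a b x : bc_scale a (bc_scale b x) = bc_scale (a * b) x.
Proof.
elim/base_changeW: x => s; rewrite !bc_scaleE -map_comp; congr cls; apply: eq_map => y /=.
by rewrite /scale_pair /= mulrA.
Qed.

Lemma bc_scale1 : left_id 1 bc_scale.
Proof.
elim/base_changeW=> s; rewrite bc_scaleE; congr cls.
by rewrite -[RHS]map_id; apply: eq_map => -[y k]; rewrite /scale_pair /= mul1r.
Qed.

Lemma bc_scaleDr : right_distributive bc_scale +%R.
Proof.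
move=> c; elim/base_changeW=> s; elim/base_changeW=> t.
rewrite -cls_cat !bc_scaleE map_cat.
exact: cls_cat.
Qed.

Lemma bc_scaleDl x : {morph bc_scale^~ x : a b / a + b}.
Proof.
move=> a b; elim/base_changeW: x => s; rewrite !bc_scaleE; apply: cls_map_add => -[y k].
rewrite -cls_cat; apply/base_changeP.
by rewrite /scale_pair /= mulrDl; exact: Tensor_addr.
Qed.

HB.instance Definition _ := GRing.Zmodule_isLmodule.Build S base_change
  bc_scaleA bc_scale1 bc_scaleDr bc_scaleDl.

Definition tensor (a : A) (k : S) : base_change := cls [:: (a, k)].

Variable mul : {bilinear A -> A -> A}.

Definition mul_pair (x y : A * S) : A * S := (mul x.1 y.1, x.2 * y.2).

Definition base_change_mul (x y : base_change) : base_change :=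
  cls [seq mul_pair u v | u <- repr x, v <- repr y].

Lemma mulE_sum (s t : formal) :
  cls [seq mul_pair u v | u <- s, v <- t] =
  \sum_(u <- s) \sum_(v <- t) cls [:: mul_pair u v].
Proof.
elim: s => [|u s IHs] /=; first by rewrite big_nil.
rewrite big_cons cls_cat IHs; congr (_ + _).
elim: t {IHs} => [|v t IHt] /=; first by rewrite big_nil.
by rewrite big_cons cls_cons IHt.
Qed.

Lemma sum_tensor_rel (V : zmodType) (f : A * S -> V) :
    (forall a b k, f (a + b, k) = f (a, k) + f (b, k)) ->
    (forall a k l, f (a, k + l) = f (a, k) + f (a, l)) ->
    (forall r a k, f (r *: a, k) = f (a, phi r * k)) ->
  forall s t, tensor_rel s t -> \sum_(u <- s) f u = \sum_(u <- t) f u.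
Proof.
move=> fDl fDr fZ s t.
elim=> {s t} [s|s t _|s t u _ -> _|s s' t t' _ ss' _ tt'|s t|k|a b k|a k l|r a k];
  rewrite ?big_cat ?big_cons ?big_nil ?addr0 //=.
- by rewrite ss' tt'.
- by rewrite addrC.
- by apply: (addrI (f (0, k))); rewrite -fDl !addr0.
Qed.

Lemma base_change_mulE (s t : formal) :
  base_change_mul (cls s) (cls t) =
  \sum_(u <- s) \sum_(v <- t) cls [:: mul_pair u v].
Proof.
rewrite /base_change_mul mulE_sum.
have inner u : \sum_(v <- repr (cls t)) cls [:: mul_pair u v] =
               \sum_(v <- t) cls [:: mul_pair u v].
  apply: sum_tensor_rel (repr_base_change t) => [a b k|a k l|r a k];
    rewrite -?cls_cat; apply/base_changeP; rewrite /mul_pair /=.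
  - by rewrite linearD; exact: Tensor_addl.
  - by rewrite mulrDr; exact: Tensor_addr.
  - by rewrite linearZ /= mulrCA; exact: Tensor_balanced.
under eq_bigr do rewrite inner.
apply: sum_tensor_rel (repr_base_change s) => [a b k|a k l|r a k];
  rewrite -?big_split /=; apply: eq_bigr => v _;
  rewrite -?cls_cat; apply/base_changeP; rewrite /mul_pair /=.
- by rewrite linearDl; exact: Tensor_addl.
- by rewrite mulrDl; exact: Tensor_addr.
- by rewrite linearZl_LR /= -mulrA; exact: Tensor_balanced.
Qed.

Lemma tensor_mul a k b l :
  base_change_mul (tensor a k) (tensor b l) = tensor (mul a b) (k * l).
Proof. by rewrite base_change_mulE !big_seq1. Qed.

Lemma base_change_mul_bilinear : bilinear_for *:%R *:%R base_change_mul.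
Proof.
split=> [y c x x'|x c y y'].
  elim/base_changeW: x => s; elim/base_changeW: x' => s'.
  elim/base_changeW: y => t; rewrite [c *: _]bc_scaleE -cls_cat.
  rewrite !base_change_mulE big_cat big_map /= scaler_sumr; congr (_ + _).
  apply: eq_bigr => u _; rewrite scaler_sumr; apply: eq_bigr => v _.
  by rewrite [RHS]bc_scaleE /= /mul_pair /scale_pair /= mulrA.
elim/base_changeW: x => s; elim/base_changeW: y => t.
elim/base_changeW: y' => t'; rewrite [c *: _]bc_scaleE -cls_cat. rewrite /=.
rewrite !base_change_mulE [in RHS]scaler_sumr -big_split /=; apply: eq_bigr => u _.
rewrite big_cat big_map /= scaler_sumr; congr (_ + _); apply: eq_bigr => v _.
by rewrite [RHS]bc_scaleE /= /mul_pair /scale_pair /= mulrCA.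
Qed.

HB.instance Definition _ := bilinear_isBilinear.Build S
  base_change base_change base_change *:%R *:%R base_change_mul
  base_change_mul_bilinear.

End BaseChange.

Definition fiber (R : comNzRingType) (A : lmodType R) (p : Spec R) :
    lmodType (residue_field p) :=
  base_change (@to_residue_field R p) A.

Definition fiber_mul (R : comNzRingType) (A : lmodType R)
    (mul : {bilinear A -> A -> A}) (p : Spec R) :
    {bilinear fiber A p -> fiber A p -> fiber A p} :=
  base_change_mul (phi := @to_residue_field R p) mul.

Section Generation.
Variables (R : comNzRingType) (A : lmodType R) (mul : {bilinear A -> A -> A}).

Definition nonunital_subalgebra (B : set A) : Prop :=
  submod_closed [in B] /\ {in B &, forall x y, mul x y \in B}.

Definition generated_by (m : nat) : Prop :=
  exists a : 'I_m -> A, smallest nonunital_subalgebra (range a) = [set: A].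

End Generation.

(* Main.v *)
Require Import Defs.
From mathcomp Require Import all_boot all_order all_algebra.
From mathcomp Require Import generic_quotient ring_quotient fraction zify.
From mathcomp Require Import sesquilinear boolp classical_sets functions topology.
From HB Require Import structures.

(** Fix a maximal ideal [p].  A family [X] in [A] generates [A] modulo [p A] iff
    the ideal of multipliers [s] with [s A] inside the subalgebra generated by
    [X] is not contained in [p]; the nontrivial direction is Nakayama's lemma
    ([generates_mod_conductor]).  Two things follow.  If [X] generates modulo
    every maximal ideal, the multipliers form the unit ideal and [X] generates
    [A] ([generates_of_mod]).  And for each [j] the locus [deficient j X], of
    those [p] where no [j] further elements complete [X] to a generating family
    modulo [p A], is closed in [MaxSpec R] ([deficient_closed]).

    By hypothesis [deficient n [::]] is empty, and one wants [n + d] elements with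
    [deficient 0 X] empty.  Elements are added one at a time.  Pick a point in
    each irreducible component of [deficient j X] that is not inside
    [deficient j.+1 X].  At such a point [j.+1] more elements suffice and [j] do
    not, so adding the first of them leaves only [j] to add.  As only residues
    matter, the Chinese remainder theorem gives a single element [a] doing this
    at all the chosen points ([dim_lt_deficient_step]).  A closed irreducible
    subset of [deficient j (a :: X)] then lies in [deficient j.+1 X] or is a
    proper subset of a component of [deficient j X], so
    [[
      dim (deficient j (a :: X)) <=
        max (dim (deficient j.+1 X)) (dim (deficient j X) - 1).
    ]]
    The loci with [n <= j] are always empty and the others start with dimension
    at most [d].  So for [j < n <= j + 1 + k], after [k] steps, [deficient j X] has
    dimension at most [d - (j + 1 + k - n)].  For [j = 0] and [k = n + d] this is
    [-1], the dimension of the empty set. *)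

Set Implicit Arguments.
Unset Strict Implicit.
Unset Printing Implicit Defensive.

Import GRing.Theory.

Local Open Scope classical_set_scope.
Local Open Scope ring_scope.

(** * Ideals of a Noetherian ring *)

Lemma submod_closedP (R : comNzRingType) (M : lmodType R) (N : set M) :
  submod_closed [in N] <->
  N 0 /\ forall r x y, N x -> N y -> N (r *: x + y).
Proof.
split=> -[N0 Nl].
  split=> [|r x y Nx Ny]; first by move: N0; rewrite inE.
  by have := Nl r x y; rewrite !inE; apply.
by split=> [|r x y]; rewrite !inE //; exact: Nl.
Qed.

Lemma submodB (R : comNzRingType) (M : lmodType R) (N : set M) (x y : M) :
  submod_closed [in N] -> N x -> N y -> N (x - y).
Proof.
move=> /submod_closedP[N0 Nl] Nx Ny; rewrite addrC -scaleN1r; exact: Nl.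
Qed.

Lemma submodD (R : comNzRingType) (M : lmodType R) (N : set M) (x y : M) :
  submod_closed [in N] -> N x -> N y -> N (x + y).
Proof. by move=> /submod_closedP[N0 Nl] Nx Ny; rewrite -[x]scale1r; exact: Nl. Qed.

Lemma submodZ (R : comNzRingType) (M : lmodType R) (N : set M) (r : R) (x : M) :
  submod_closed [in N] -> N x -> N (r *: x).
Proof. by move=> /submod_closedP[N0 Nl] Nx; rewrite -[_ *: _]addr0; exact: Nl. Qed.

Lemma submod_sum (R : comNzRingType) (M : lmodType R) (N : set M) (I : finType)
    (c : I -> R) (x : I -> M) :
  submod_closed [in N] -> (forall i, N (x i)) -> N (\sum_i c i *: x i).
Proof.
move=> /submod_closedP[N0 Nl] Nx.
by elim/big_rec: _ => // i y _; exact: Nl.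
Qed.

(** An infinite strictly increasing sequence of ideals has a union that is
    finitely generated, so its generators already lie in some term. *)
Lemma noetherian_maximal (R : comNzRingType) (P : set (set R^o)) :
  noetherian R -> (forall I, P I -> submod_closed [in I]) -> P !=set0 ->
  exists I, P I /\ forall J, P J -> I `<=` J -> J `<=` I.
Proof.
move=> Rn Pideal [I0 PI0]; apply: contrapT => noMax.
have next (I : {I | P I}) : exists J : {I | P I}, sval I `<` sval J.
  case: I => I PI /=; apply: contrapT => noJ; apply: noMax.
  exists I; split=> // J PJ IJ; apply: contrapT => NJI; apply: noJ.
  by exists (exist _ J PJ).
have [f fP] := choice next.
pose I k := sval (iter k f (exist _ I0 PI0)).
have PI k : P (I k) by exact: (svalP (iter k f _)).
have Imono i j : (i <= j)%N -> I i `<=` I j.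
  move=> /subnKC <-; elim: (j - i)%N => [|k IH]; first by rewrite addn0.
  by apply: subset_trans IH _; rewrite addnS; exact: properW (fP _).
pose U : set R^o := \bigcup_k I k.
have Ucl : submod_closed [in U].
  apply/submod_closedP; split.
    by exists 0%N => //; case: (submod_closedP (I 0%N)) => /(_ (Pideal _ (PI _)))[].
  move=> r x y [i _ xi] [j _ yj]; exists (maxn i j) => //.
  have [_ Il] := (submod_closedP (I (maxn i j))).1 (Pideal _ (PI _)).
  by apply: Il; [apply: Imono xi; exact: leq_maxl|apply: Imono yj; exact: leq_maxr].
have [m [g Ug]] := Rn U Ucl.
have gU i : exists k, I k (g i).
  have : U (g i).
    rewrite Ug; exists (fun j => (j == i)%:R) => //.
    by rewrite (bigD1 i) //= eqxx scale1r big1 ?addr0 // => j /negPf->; rewrite scale0r.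
  by move=> [k _]; exists k.
have [k kP] := choice gU.
pose K := (\max_i k i)%N.
have UK : U `<=` I K.
  rewrite Ug => _ [c _ <-]; apply: submod_sum; first exact: Pideal.
  by move=> i; apply: Imono (kP i); exact: leq_bigmax.
have [_] := fP (iter K f (exist _ I0 PI0)).
by apply=> x xK; apply: UK; exists K.+1.
Qed.

(** Besides its membership predicate, a prime ideal consists of proofs only. *)
Lemma Spec_ext (R : comNzRingType) (p q : Spec R) : p =i q -> p = q.
Proof.
case: p q => [sp cp] [sq cq] /= pq.
have {}pq : sp = sq by apply/funext=> x; exact: pq.
subst sq; f_equal.
case: cp; case: cq => [[q1] [q2] [q3] [q4]] [p1] [p2] [p3] [p4].
by congr PrimeIdealr.Class; f_equal; exact: Prop_irrelevance.
Qed.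

Lemma idealr_of_submod (R : comNzRingType) (I : set R^o) : submod_closed [in I] -> ~ I 1 ->
  exists J : idealr R, [set` J] = I.
Proof.
move=> Icl I1.
pose S : R -> bool := fun x => `[< I x >].
have [I0 Il] := (submod_closedP I).1 Icl.
have Scl : idealr_closed S.
  split; first exact/asboolP.
    by apply/asboolP.
  by move=> a u v /asboolP Iu /asboolP Iv; apply/asboolP; exact: Il.
pose J : idealr R := HB.pack S (isIdealr.Build R S Scl).
exists J; apply/seteqP; split=> x; first by move/asboolP.
by move=> Ix; apply/asboolP.
Qed.

Lemma submod_adjoin (R : comNzRingType) (I : set R^o) (x : R) :
  submod_closed [in I] ->
  submod_closed [in [set y : R^o | exists r z, I z /\ y = r * x + z]].
Proof.
move=> /submod_closedP[I0 Il]; apply/submod_closedP; split.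
  by exists 0, 0; rewrite mul0r addr0.
move=> a _ _ [r [z [Iz ->]]] [r' [z' [Iz' ->]]]; exists (a * r + r'), (a *: z + z').
by split; [exact: Il|rewrite scalerDr mulrDl -mulrA addrACA].
Qed.

(** Otherwise [p] and [x] would span a proper ideal larger than [p]. *)
Lemma mem_maximal_inv (R : comNzRingType) (p : Spec R) (x : R) :
  maximal_point p -> x \notin p -> exists r, r * x - 1 \in p.
Proof.
move=> pmax xp; apply: contrapT => noinv.
pose I : set R^o := [set y | exists r z, z \in p /\ y = r * x + z].
have Icl : submod_closed [in I].
  apply: (@submod_adjoin R [set` p]); apply/submod_closedP; split=> [|r y z yp zp].
    exact: rpred0.
  by rewrite /= rpredD // idealMr.
have I1 : ~ I 1.
  move=> [r [z [zp e]]]; apply: noinv; exists r.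
  by rewrite e opprD addrA subrr sub0r rpredN.
have [J JI] := idealr_of_submod Icl I1.
have JE y : (y \in J) = `[< I y >] by apply/idP/asboolP; rewrite -JI.
move/negP: xp; apply; apply: (pmax J) => [y yp|].
  by rewrite JE; apply/asboolP; exists 0, y; rewrite mul0r add0r.
by rewrite JE; apply/asboolP; exists 1, 0; rewrite mul1r addr0 rpred0.
Qed.

(** An ideal maximal among the proper ideals containing [I] is prime: an element
    outside it spans the unit ideal together with it. *)
Lemma exists_maximal_point (R : comNzRingType) (I : set R^o) :
  noetherian R -> submod_closed [in I] -> ~ I 1 ->
  exists2 p : Spec R, maximal_point p & forall x, I x -> x \in p.
Proof.
move=> Rn Icl I1.
pose P := [set J : set R^o | [/\ submod_closed [in J], ~ J 1 & I `<=` J]].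
have [|| J [[Jcl J1 IJ] Jmax]] := noetherian_maximal (P := P) Rn.
- by move=> J [].
- by exists I; split.
pose S : R -> bool := fun x => `[< J x >].
have [J0 Jl] := (submod_closedP J).1 Jcl.
have Scl : idealr_closed S.
  split; [exact/asboolP|exact/asboolP|].
  by move=> a u v /asboolP Iu /asboolP Iv; apply/asboolP; exact: Jl.
have Jinv x : ~ J x -> exists r z, J z /\ 1 = r * x + z.
  move=> Jx; apply: contrapT => noinv; apply: Jx.
  pose K : set R^o := [set y | exists r z, J z /\ y = r * x + z].
  apply: (Jmax K); last 1 [idtac].
    split.
    - exact: submod_adjoin.
    - exact: noinv.
    - by move=> y Iy; exists 0, y; rewrite mul0r add0r; split=> //; exact: IJ.
    by move=> y Jy; exists 0, y; rewrite mul0r add0r.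
  by exists 1, 0; rewrite mul1r addr0.
have Sprime : prime_idealr_closed S.
  move=> u v /asboolP Juv; apply/orP; rewrite /in_mem /=.
  have [Ju|/Jinv[r [z [Jz e]]]] := pselect (J u); first by left; exact/asboolP.
  right; apply/asboolP.
  have -> : v = r *: (u * v : R^o) + (v *: z + 0) :> R^o.
    by rewrite addr0 -[LHS]mul1r e mulrDl -mulrA (mulrC z).
  by apply: (Jl) => //; exact: Jl.
pose p : Spec R := HB.pack S (isIdealr.Build R S Scl)
  (isPrimeIdealrClosed.Build R S Sprime).
exists p => [K pK x xK|x Ix]; last by apply/asboolP/IJ.
apply/asboolP; apply: contrapT => /Jinv[r [z [Jz e]]].
have := idealr1 K; rewrite e rpredD // ?idealMr //.
by apply: pK; exact/asboolP.
Qed.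

(** * Dimension in Noetherian spaces *)

Section NoetherianSpace.
Variable T : topologicalType.

(** The descending chain condition on closed sets, as a minimality principle. *)
Definition noetherian_space : Prop :=
  forall P : set (set T), (forall F, P F -> closed F) -> P !=set0 ->
    exists F, P F /\ forall G, P G -> G `<=` F -> F `<=` G.

(** [dim_lt F e] is meant for closed [F]; bounding lengths strictly gives the
    empty set the dimension bound [0]. *)
Definition dim_lt (F : set T) (e : nat) : Prop :=
  forall k X, irreducible_chain k X -> X k `<=` F -> (k < e)%N.

Lemma dim_lt_leq (F : set T) (e e' : nat) :
  (e <= e')%N -> dim_lt F e -> dim_lt F e'.
Proof. by move=> ee' Fe k X Xch XF; exact: leq_trans (Fe k X Xch XF) ee'. Qed.

Lemma irreducible_closure1 (x : T) : irreducible (closure [set x]).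
Proof.
split; first by exists x; exact: subset_closure.
move=> F G Fcl Gcl xFG.
have [Fx|Gx] := xFG x (subset_closure (erefl x)); [left|right].
  by rewrite [X in _ `<=` X]((closure_id _).1 Fcl); apply: closure_subset => _ ->.
by rewrite [X in _ `<=` X]((closure_id _).1 Gcl); apply: closure_subset => _ ->.
Qed.

(** The closure of a point is already a chain of length [0]. *)
Lemma dim_lt0 (F : set T) : closed F -> dim_lt F 0 -> F = set0.
Proof.
move=> Fcl F0; apply/seteqP; split=> // x Fx.
suff : (0 < 0)%N by [].
apply: (F0 0%N (fun=> closure [set x])).
  split=> // i _; split; first exact: closed_closure.
  exact: irreducible_closure1.
by rewrite [X in _ `<=` X]((closure_id _).1 Fcl); apply: closure_subset => _ ->.
Qed.

Lemma irreducible_chain_rcons (k : nat) (X : nat -> set T) (Z : set T) :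
  irreducible_chain k X -> closed Z -> irreducible Z -> X k `<` Z ->
  irreducible_chain k.+1 (fun i => if (i <= k)%N then X i else Z).
Proof.
move=> [Xirr Xlt] Zcl Zirr XZ; split=> i.
  by case: (leqP i k) => [ik|_] _ //; exact: Xirr.
rewrite ltnS => ik; rewrite ik; case: (ltnP i k) => [|ki]; first exact: Xlt.
by have -> : i = k by apply/eqP; rewrite eqn_leq ik.
Qed.

(** The points are taken one in each irreducible component of [F] not contained
    in [G].  A minimal closed [F] without such points is not irreducible,
    since one point outside [G] would do; so it is the union of two smaller closed
    sets, and the points chosen for these serve for [F]. *)
Lemma noetherian_sample (F G : set T) : noetherian_space -> closed F ->
  exists s : seq T, {in s, forall p, F p /\ ~ G p} /\
    forall X, closed X -> irreducible X -> X `<=` F ->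
      {in s, forall p, ~ X p} ->
    X `<=` G \/ exists Z, [/\ closed Z, irreducible Z, X `<` Z & Z `<=` F].
Proof.
move=> Tn; pose sample (F : set T) (s : seq T) := {in s, forall p, F p /\ ~ G p} /\
    forall X, closed X -> irreducible X -> X `<=` F ->
      {in s, forall p, ~ X p} ->
    X `<=` G \/ exists Z, [/\ closed Z, irreducible Z, X `<` Z & Z `<=` F].
change (closed F -> exists s, sample F s) => Fcl0; apply: contrapT => Fbad0.
have [|| {Fbad0 Fcl0}F [[Fcl Fbad] Fmin]] :=
  Tn [set F | closed F /\ ~ exists s, sample F s].
- by move=> ? [].
- by exists F.
have Fsub H : closed H -> H `<` F -> exists s, sample H s.
  move=> Hcl [HF NFH]; apply: contrapT => Hbad; apply: NFH.
  by apply: Fmin => //; split.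
have [FG|/existsNP[x /not_implyP[Fx NGx]]] := pselect (F `<=` G).
  by apply: Fbad; exists [::]; split=> // X _ _ XF _; left; exact: subset_trans FG.
have [Firr|NFirr] := pselect (irreducible F).
  apply: Fbad; exists [:: x]; split=> [p|X Xcl Xirr XF Xx].
    by rewrite inE => /eqP->.
  right; exists F; split=> //; split=> // FX.
  by apply: (Xx x); [rewrite inE|exact: FX].
have [H [K [Hcl Kcl FHK FH FK]]] : exists H K, [/\ closed H, closed K,
    F `<=` H `|` K, ~ (F `<=` H) & ~ (F `<=` K)].
  apply: contrapT => NHK; apply: NFirr; split; first by exists x.
  move=> H K Hcl Kcl FHK; apply: contrapT => /not_orP[FH FK].
  by apply: NHK; exists H, K.
have proper L : ~ (F `<=` L) -> F `&` L `<` F.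
  by move=> NFL; split=> [y []//|FFL]; apply: NFL => y /FFL[].
have [s [sF sX]] := Fsub _ (closedI Fcl Hcl) (proper _ FH).
have [t [tF tX]] := Fsub _ (closedI Fcl Kcl) (proper _ FK).
apply: Fbad; exists (s ++ t); split=> [p|X Xcl Xirr XF Xst].
  by rewrite mem_cat => /orP[/sF|/tF] [[]].
have [XH|XK] := Xirr.2 _ _ Hcl Kcl (subset_trans XF FHK).
- have [|||[Z [Zcl Zirr XZ ZF]]] := sX X Xcl Xirr.
  + by move=> y Xy; split; auto.
  + by move=> p ps; apply: Xst; rewrite mem_cat ps.
  + by left.
  + by right; exists Z; split=> // y /ZF[].
- have [|||[Z [Zcl Zirr XZ ZF]]] := tX X Xcl Xirr.
  + by move=> y Xy; split; auto.
  + by move=> p ps; apply: Xst; rewrite mem_cat ps orbT.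
  + by left.
  + by right; exists Z; split=> // y /ZF[].
Qed.

(** Removing a point from every component of [F] that is not inside [G] lowers
    the dimension, except for the part that remains inside [G]. *)
Lemma dim_lt_sample (F G : set T) (e : nat) : noetherian_space -> closed F ->
  dim_lt F e.+1 -> dim_lt G e ->
  exists s : seq T, {in s, forall p, F p /\ ~ G p} /\
    forall F', F' `<=` F -> {in s, forall p, ~ F' p} -> dim_lt F' e.
Proof.
move=> Tn Fcl Fe Ge; have [s [sF sX]] := noetherian_sample G Tn Fcl.
exists s; split=> // F' F'F sF' k X Xch XF'.
have [Xkcl Xkirr] := Xch.1 k (leqnn k).
have [||XG|[Z [Zcl Zirr XZ ZF]]] := sX (X k) Xkcl Xkirr.
- exact: subset_trans F'F.
- by move=> p ps /XF'; exact: sF'.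
- exact: Ge Xch XG.
- rewrite -ltnS; apply: (Fe _ _ (irreducible_chain_rcons Xch Zcl Zirr XZ)).
  by rewrite ltnn.
Qed.

End NoetherianSpace.

(** * The maximal spectrum *)

Section MaxSpecTopology.
Variable R : comNzRingType.

Definition max_locus (S : set R) : set (MaxSpec R) :=
  [set p : MaxSpec R | forall x, S x -> x \in (set_val p : Spec R)].

Lemma MaxSpec_closedP (F : set (MaxSpec R)) :
  closed F <-> exists S, F = max_locus S.
Proof.
split=> [Fcl|[S ->]].
  case: (closed_openC Fcl) => U openU UF.
  have [S US] : zariski_open U := openU.
  by exists S; rewrite -[F]setCK -UF US preimage_setC setCK.
by rewrite -[max_locus S]setCK; apply: open_closedC; exists (~` zero_locus S) => //; exists S.
Qed.

(** A closed set is recovered from its vanishing ideal, so a maximal vanishing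
    ideal belongs to a minimal closed set. *)
Lemma MaxSpec_noetherian : noetherian R -> noetherian_space (MaxSpec R).
Proof.
move=> Rn P Pcl [F0 PF0].
pose van (F : set (MaxSpec R)) : set R^o := [set x | forall p, F p -> x \in (set_val p : Spec R)].
have vanK F : P F -> max_locus (van F) `<=` F.
  move=> /Pcl/MaxSpec_closedP[S ->] p pS x Sx; apply: pS => q; exact.
have [||_ [[F PF <-] Fmax]] := noetherian_maximal (P := van @` P) Rn.
- move=> _ [F PF <-]; apply/submod_closedP; split=> [p _|r x y Fx Fy p Fp].
    exact: rpred0.
  by rewrite rpredD ?idealMr ?Fx ?Fy.
- by exists (van F0), F0.
exists F; split=> // G PG GF p Fp; apply: (vanK G PG) => x Gx.
apply: (Fmax (van G) _ _ x Gx) p Fp; first by exists G.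
by move=> y Fy q /GF; exact: Fy.
Qed.

End MaxSpecTopology.

(** * Multiples of an ideal *)

Section IdealMultiple.
Variables (R : comNzRingType) (A : lmodType R) (p : Spec R).

(** The submodule [p A]. *)
Definition ideal_multiple : set A :=
  smallest (fun N : set A => submod_closed [in N])
    [set y | exists r x, r \in p /\ y = r *: x].

Lemma ideal_multiple_submod : submod_closed [in ideal_multiple].
Proof.
apply/submod_closedP; split=> [N [/submod_closedP[]//]|r x y Nx Ny N NN].
by have [/submod_closedP[_ Nl] _] := NN; apply: Nl; [exact: Nx|exact: Ny].
Qed.

Lemma ideal_multipleZ (r : R) (x : A) : r \in p -> ideal_multiple (r *: x).
Proof. by move=> rp; apply: sub_gen_smallest; exists r, x. Qed.

Lemma ideal_multiple_ind (N : set A) :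
  submod_closed [in N] -> (forall r x, r \in p -> N (r *: x)) ->
  ideal_multiple `<=` N.
Proof. by move=> Ncl Nr; apply: smallest_sub => // _ [r [x [rp ->]]]; exact: Nr. Qed.

Lemma ideal_multiple_coord (m : nat) (g : 'I_m -> A) (x : A) :
  [set: A] = range (fun c : 'I_m -> R => \sum_i c i *: g i) ->
  ideal_multiple x -> exists c : 'I_m -> R,
    (forall i, c i \in p) /\ x = \sum_i c i *: g i.
Proof.
move=> gA; move: x; apply: ideal_multiple_ind.
  apply/submod_closedP; split.
    exists (fun=> 0); split; first by move=> _; exact: rpred0.
    by rewrite big1 // => i _; rewrite scale0r.
  move=> r _ _ [c [cp ->]] [c' [cp' ->]]; exists (fun i => r * c i + c' i); split.
    by move=> i; rewrite rpredD ?idealMr.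
  rewrite scaler_sumr -big_split; apply: eq_bigr => i _.
  by rewrite scalerA scalerDl.
move=> r x rp; have : [set: A] x by [].
rewrite gA => -[c _ <-]; exists (fun i => r * c i); split.
  by move=> i; rewrite mulrC idealMr.
by rewrite scaler_sumr; apply: eq_bigr => i _; rewrite scalerA.
Qed.

End IdealMultiple.

Arguments ideal_multiple {R} A p _.

(** * Residue fields *)

Lemma fraction_quotient (D : idomainType) (x : {fraction D}) :
  exists a b : D, b != 0 /\ x = tofrac a / tofrac b.
Proof.
elim/quotW: x => x; exists \n_x, \d_x; split; first exact: denom_ratioP.
apply: (@mulIf _ (tofrac \d_x)); first by rewrite tofrac_eq0 denom_ratioP.
rewrite divfK ?tofrac_eq0 ?denom_ratioP //; unlock FracField.tofrac.
rewrite -[LHS]FracField.pi_mul; apply/eqP; rewrite FracField.equivf_def.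
have d0 : \d_x != 0 by exact: denom_ratioP.
have o0 : (1 : D) != 0 by exact: oner_neq0.
by rewrite /FracField.mulf !numden_Ratio ?mulr1 ?d0 // mulrC.
Qed.

Section ResidueField.
Variables (R : comNzRingType) (p : Spec R).

Lemma to_residue_field_eq0 (r : R) : (to_residue_field p r == 0) = (r \in p).
Proof.
rewrite /to_residue_field tofrac_eq0 -[in RHS](subr0 r).
by rewrite Quotient.idealrBE pi_zeror.
Qed.

(** For maximal [p] a denominator is already invertible modulo [p], so the
    fraction field adds nothing to the quotient ring. *)
Lemma to_residue_field_surj (k : residue_field p) :
  maximal_point p -> exists r, to_residue_field p r = k.
Proof.
move=> pmax; have [a [b [b0 ->]]] := fraction_quotient k.
have repr_tofrac (y : residue_ring p) : to_residue_field p (repr y) = tofrac y.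
  by rewrite /to_residue_field reprK.
have [|r rb] := @mem_maximal_inv _ p (repr b) pmax.
  by rewrite -to_residue_field_eq0 repr_tofrac tofrac_eq0.
exists (repr a * r); rewrite rmorphM /= repr_tofrac; congr (_ * _).
apply: (@mulIf _ (tofrac b)); first by rewrite tofrac_eq0.
rewrite mulVf ?tofrac_eq0 // -repr_tofrac -rmorphM; apply/eqP.
by rewrite -subr_eq0 -(rmorph1 (to_residue_field p)) -rmorphB to_residue_field_eq0.
Qed.
End ResidueField.

(** * Subalgebras modulo a maximal ideal *)

Section Subalgebra.
Variables (R : comNzRingType) (A : lmodType R) (mul : {bilinear A -> A -> A}).

Lemma nonunital_subalgebraP (B : set A) :
  nonunital_subalgebra mul B <->
  submod_closed [in B] /\ forall x y, B x -> B y -> B (mul x y).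
Proof.
split=> -[Bcl Bmul]; split=> // x y.
  by move=> Bx By; have := Bmul x y; rewrite !inE; apply.
by rewrite !inE; exact: Bmul.
Qed.

Definition subalgebra (X : set A) : set A := smallest (nonunital_subalgebra mul) X.

Lemma subalgebra_closed (X : set A) : nonunital_subalgebra mul (subalgebra X).
Proof.
apply/nonunital_subalgebraP; split.
  apply/submod_closedP; split.
    by move=> B [/nonunital_subalgebraP[/submod_closedP[]]].
  move=> r x y Xx Xy B BX.
  have [/nonunital_subalgebraP[/submod_closedP[_ Bl] _] _] := BX.
  by apply: Bl; [exact: Xx|exact: Xy].
move=> x y Xx Xy B BX.
have [/nonunital_subalgebraP[_ Bm] _] := BX.
by apply: Bm; [exact: Xx|exact: Xy].
Qed.

Lemma subalgebra_sub (X Y : set A) :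
  X `<=` subalgebra Y -> subalgebra X `<=` subalgebra Y.
Proof. by apply: smallest_sub; exact: subalgebra_closed. Qed.

(** This says that [X] generates the quotient of [A] by [p A].  Adding [p A] to
    the generators avoids forming the quotient and makes it plain that only the
    residues of [X] matter. *)
Definition generates_mod (p : Spec R) (X : set A) : Prop :=
  subalgebra (X `|` ideal_multiple A p) = [set: A].

(** [p A] is an ideal of [A], so its sum with a subalgebra is a subalgebra. *)
Lemma subalgebra_mod (p : Spec R) (X : set A) (x : A) :
  subalgebra (X `|` ideal_multiple A p) x ->
  exists2 b, subalgebra X b & ideal_multiple A p (x - b).
Proof.
set I := ideal_multiple A p; have Icl : submod_closed [in I] := ideal_multiple_submod A p.
have [I0 Il] := (submod_closedP I).1 Icl.
have [/submod_closedP[B0 Bl] Bm] := (nonunital_subalgebraP _).1 (subalgebra_closed X).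
have Imr y : I `<=` [set x | I (mul x y)].
  apply: ideal_multiple_ind => [|r z rp].
    apply/submod_closedP; split=> [|r z t Iz It] /=; first by rewrite linear0l.
    by rewrite linearPl; exact: Il.
  by rewrite /= linearZl_LR; exact: ideal_multipleZ.
have Iml y : I `<=` [set x | I (mul y x)].
  apply: ideal_multiple_ind => [|r z rp].
    apply/submod_closedP; split=> [|r z t Iz It] /=; first by rewrite linear0.
    by rewrite linearP; exact: Il.
  by rewrite /= linearZ; exact: ideal_multipleZ.
suff : subalgebra (X `|` I) `<=` [set x | exists2 b, subalgebra X b & I (x - b)].
  by apply.
apply: smallest_sub; last first.
  move=> {}x [Xx|Ix]; first by exists x; [exact: sub_gen_smallest|rewrite subrr].
  by exists 0; rewrite ?subr0.
apply/nonunital_subalgebraP; split.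
  apply/submod_closedP; split; first by exists 0; rewrite ?subr0.
  move=> r {}x y [b Bb Ib] [c Bc Ic]; exists (r *: b + c); first exact: Bl.
  by rewrite opprD addrACA -scalerBr; exact: Il.
move=> {}x y [b Bb Ib] [c Bc Ic]; exists (mul b c); first exact: Bm.
have -> : mul x y - mul b c = mul (x - b) y + mul b (y - c).
  by rewrite linearBl linearBr addrA subrK.
by apply: (submodD Icl); [exact: Imr|exact: Iml].
Qed.

(** Nakayama's lemma in its determinant form: modulo the subalgebra, generators
    of the module satisfy a square system congruent to the identity modulo [p],
    whose determinant is then a multiplier outside [p]. *)
Lemma generates_mod_conductor (p : Spec R) (X : set A) :
  finitely_generated [set: A] -> generates_mod p X ->
  exists2 s, s \notin p & forall x, subalgebra X (s *: x).
Proof.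
move=> [m [g gA]] Xgen.
have [Bcl _] := (nonunital_subalgebraP _).1 (subalgebra_closed X).
have gmod i : exists bC : A * ('I_m -> R), [/\ subalgebra X bC.1,
    forall j, bC.2 j \in p & g i = bC.1 + \sum_j bC.2 j *: g j].
  have [|b Bb /(ideal_multiple_coord gA)[c [cp cE]]] := @subalgebra_mod p X (g i).
    by rewrite -/(generates_mod p X) Xgen.
  by exists (b, c); split=> //=; rewrite -cE addrC subrK.
have [bC bCP] := choice gmod.
pose M : 'M[R]_m := 1%:M - \matrix_(i, j) (bC i).2 j.
have Mb i : \sum_j M i j *: g j = (bC i).1.
  have [_ _ gi] := bCP i.
  rewrite -[RHS](addrK (\sum_j (bC i).2 j *: g j)) -gi.
  under eq_bigr do rewrite !mxE scalerBl.
  rewrite sumrB; congr (_ - _).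
  rewrite (bigD1 i) //= eqxx scale1r big1 ?addr0 // => j.
  by rewrite eq_sym => /negPf->; rewrite scale0r.
have adjM k : \det M *: g k = \sum_i (\adj M) k i *: (bC i).1.
  under eq_bigr do rewrite -Mb scaler_sumr.
  rewrite exchange_big /=.
  under eq_bigr => j _ do under eq_bigr do rewrite scalerA.
  under eq_bigr => j _.
    rewrite -scaler_suml.
    have -> : \sum_i \adj M k i * M i j = (\adj M *m M) k j by rewrite mxE.
    rewrite mul_adj_mx mxE; over.
  rewrite (bigD1 k) //= eqxx mulr1n big1 ?addr0 // => j.
  by rewrite eq_sym => /negPf->; rewrite mulr0n scale0r.
exists (\det M).
  rewrite -to_residue_field_eq0 -det_map_mx.
  have -> : map_mx (to_residue_field p) M = 1%:M.
    rewrite /M map_mxB map_mx1 -[RHS]subr0; congr (_ - _).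
    apply/matrixP=> i j; rewrite !mxE; apply/eqP; rewrite to_residue_field_eq0.
    by have [_] := bCP i.
  by rewrite det1 oner_eq0.
move=> x; have : [set: A] x by [].
rewrite gA => -[c _ <-]; rewrite scaler_sumr.
have -> : \sum_i \det M *: (c i *: g i) = \sum_i c i *: (\det M *: g i).
  by apply: eq_bigr => i _; rewrite !scalerA mulrC.
apply: (submod_sum _ Bcl) => k; rewrite adjM; apply: (submod_sum _ Bcl) => i.
by have [] := bCP i.
Qed.

(** [s] is invertible modulo [p], so [s A] and [p A] together span [A]. *)
Lemma conductor_generates_mod (p : Spec R) (X : set A) (s : R) :
  maximal_point p -> s \notin p -> (forall x, subalgebra X (s *: x)) ->
  generates_mod p X.
Proof.
move=> pmax sp Xs; apply/seteqP; split=> // x _.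
have [r rsp] := mem_maximal_inv pmax sp.
have [Bcl _] := (nonunital_subalgebraP _).1 (subalgebra_closed (X `|` ideal_multiple A p)).
have -> : x = r *: (s *: x) - (r * s - 1) *: x.
  by rewrite scalerBl scale1r scalerA opprB addrC subrK.
apply: (submodB Bcl).
  apply: (submodZ _ Bcl); apply: subalgebra_sub (Xs x) => y Xy.
  by apply: sub_gen_smallest; left.
by apply: sub_gen_smallest; right; exact: ideal_multipleZ.
Qed.

(** The multipliers of [A] into the subalgebra form an ideal contained in no
    maximal ideal, so [1] is one of them. *)
Lemma generates_of_mod (X : set A) : noetherian R -> finitely_generated [set: A] ->
  (forall p : Spec R, maximal_point p -> generates_mod p X) ->
  subalgebra X = [set: A].
Proof.
move=> Rn Afg Xp.
have [/submod_closedP[B0 Bl] _] := (nonunital_subalgebraP _).1 (subalgebra_closed X).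
pose I : set R^o := [set s | forall x, subalgebra X (s *: x)].
have Icl : submod_closed [in I].
  apply/submod_closedP; split=> [x|r s t Is It x]; first by rewrite scale0r.
  by rewrite scalerDl -scalerA; exact: Bl.
have [I1|NI1] := pselect (I 1).
  by apply/seteqP; split=> // x _; rewrite -[x]scale1r; exact: I1.
have [p pmax Ip] := exists_maximal_point Rn Icl NI1.
have [s sp Is] := generates_mod_conductor Afg (Xp p pmax).
by move: sp; rewrite (Ip s Is).
Qed.

End Subalgebra.

(** * Fibres at maximal ideals *)

Section Fiber.
Variables (R : comNzRingType) (A : lmodType R) (mul : {bilinear A -> A -> A}).
Variables (p : Spec R) (pmax : maximal_point p).
Local Notation phi := (to_residue_field p).
Local Notation I := (ideal_multiple A p).
Local Notation tens := (@tensor R (residue_field p) phi A).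

Lemma fiber_tensor1 (x : fiber A p) : exists a : A, x = tens a 1.
Proof.
elim/base_changeW: x => s; elim: s => [|[a k] s [b IH]].
  by exists 0; apply/base_changeP/Tensor_sym/Tensor_0l.
have [r rk] := to_residue_field_surj k pmax.
exists (r *: a + b); rewrite cls_cons IH /tensor -cls_cat -rk; apply/base_changeP.
apply: Tensor_sym; apply: Tensor_trans (Tensor_addl _ _ _ _) _.
apply: (@Tensor_cat _ _ _ _ [:: _] [:: _] [:: _] [:: _]); last exact: Tensor_refl.
by rewrite -[X in [:: (a, X)]]mulr1; exact: Tensor_balanced.
Qed.

(** Lifting the scalars of a formal sum to [R] is well defined modulo
    the multiples of [p]: this is the map from the fibre to [A] modulo [p A]. *)
Lemma fiber_tensor1_eq (a b : A) : tens a 1 = tens b 1 -> I (a - b).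
Proof.
move=> /base_changeP; have Icl := ideal_multiple_submod A p.
have lift k : exists r, phi r = k := to_residue_field_surj k pmax.
have [rho rhoK] := choice lift.
pose ev (s : seq (A * residue_field p)) := \sum_(u <- s) rho u.2 *: u.1.
have rhoP r s x : phi r = phi s -> I (r *: x - s *: x).
  move=> /eqP; rewrite -subr_eq0 -rmorphB to_residue_field_eq0 -scalerBl.
  exact: ideal_multipleZ.
have evP s t : tensor_rel phi s t -> I (ev s - ev t).
  elim=> {s t} [s|s t _|s t u _ st _|s s' t t' _ ss' _ tt'|s t|k|x y k|x k l|r x k].
  - by rewrite subrr; case/submod_closedP: Icl.
  - by move=> st; rewrite -opprB -scaleN1r; exact: (submodZ _ Icl).
  - by move=> tu; rewrite -(subrK (ev t) (ev s)) -addrA; exact: (submodD Icl).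
  - by rewrite /ev !big_cat opprD addrACA; exact: (submodD Icl).
  - by rewrite /ev !big_cat [X in X - _]addrC subrr; case/submod_closedP: Icl.
  - by rewrite /ev big_seq1 big_nil scaler0 subrr; case/submod_closedP: Icl.
  - by rewrite /ev !big_cons !big_nil !addr0 scalerDr subrr; case/submod_closedP: Icl.
  - rewrite /ev !big_cons !big_nil !addr0 -scalerDl; apply: rhoP.
    by rewrite rmorphD /= !rhoK.
  - rewrite /ev !big_seq1 scalerA; apply: rhoP.
    by rewrite rmorphM /= !rhoK mulrC.
move=> /evP; rewrite /ev !big_seq1 /= -scalerBr => Iab.
rewrite -(scale1r (a - b)) -(subrK (rho 1 *: (a - b)) (1 *: _)).
apply: (submodD Icl) => //; apply: rhoP.
by rewrite rhoK rmorph1.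
Qed.

(** Since the scalars of the fibre lift to [R], the image of a subalgebra of [A]
    is a subalgebra of the fibre. *)
Lemma fiber_generates_mod (n : nat) : generated_by (fiber_mul mul p) n ->
  exists2 X : seq A, size X = n & generates_mod mul p [set` X].
Proof.
move=> [b bgen]; have [a aE] := choice (fun i => fiber_tensor1 (b i)).
have [/submod_closedP[B0 Bl] Bm] := (nonunital_subalgebraP mul _).1
  (subalgebra_closed mul (range a `|` I)).
exists [seq a i | i <- enum 'I_n]; first by rewrite size_map size_enum_ord.
have -> : [set` [seq a i | i <- enum 'I_n]] = range a.
  apply/seteqP; split=> [x /mapP[i _ ->]|_ [i _ <-]]; first by exists i.
  by apply/mapP; exists i; rewrite ?mem_enum.
apply/seteqP; split=> // x _.
suff : [set: fiber A p] `<=`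
    [set z | exists2 y, subalgebra mul (range a `|` I) y & z = tens y 1].
  move=> /(_ (tens x 1) Logic.I)[y By /fiber_tensor1_eq Ixy].
  rewrite -(subrK y x) -[x - y]scale1r; apply: Bl => //.
  by apply: sub_gen_smallest; right.
rewrite -bgen; apply: smallest_sub; last first.
  by move=> _ [i _ <-]; exists (a i); rewrite // ; apply: sub_gen_smallest; left; exists i.
apply/nonunital_subalgebraP; split.
  apply/submod_closedP; split.
    by exists 0 => //; apply/base_changeP/Tensor_sym/Tensor_0l.
  move=> k _ _ [y By ->] [z Bz ->].
  have [r <-] := to_residue_field_surj k pmax.
  exists (r *: y + z); first exact: Bl.
  rewrite [X in X + _]bc_scaleE /tensor -cls_cat; apply/base_changeP.
  apply: Tensor_sym; apply: Tensor_trans (Tensor_addl _ _ _ _) _.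
  apply: (@Tensor_cat _ _ _ _ [:: _] [:: _] [:: _] [:: _]); last exact: Tensor_refl.
  exact: Tensor_balanced.
move=> _ _ [y By ->] [z Bz ->]; exists (mul y z); first exact: Bm.
by rewrite [LHS]tensor_mul mulr1.
Qed.

End Fiber.

(** * The Chinese remainder theorem for modules *)

Lemma prime_mem_prod (R : comNzRingType) (p : Spec R) (I : eqType) (s : seq I)
    (f : I -> R) :
  (\prod_(i <- s) f i \in p) = has (fun i => f i \in p) s.
Proof.
elim: s => [|i s IH]; first by rewrite big_nil idealr1.
by rewrite big_cons prime_idealrM IH.
Qed.

(** Each [q] in [s] has an element outside [p]; the product of these elements is
    outside [p] by primality, hence invertible modulo [p]. *)
Lemma maximal_ideal_avoid (R : comNzRingType) (p : Spec R) (s : seq (Spec R)) :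
  {in s, forall q, maximal_point q} -> p \notin s ->  maximal_point p ->
  exists2 e, e - 1 \in p & {in s, forall q : Spec R, e \in q}.
Proof.
move=> smax ps pmax.
have [u uP] : exists u : Spec R -> R, {in s, forall q : Spec R, u q \in q /\ u q \notin p}.
  suff /choice[u uP] : forall q : Spec R, exists r, q \in s -> r \in q /\ r \notin p.
    by exists u.
  move=> q; have [qs|_] := boolP (q \in s); last by exists 0.
  apply: contrapT => Nqp; move/negP: ps; apply.
  have qp : {subset q <= p}.
    move=> x xq; apply: contrapT => /negP xp; apply: Nqp; by exists x.
  by rewrite (_ : p = q) //; apply: Spec_ext => x; apply/idP/idP; [exact: smax|exact: qp].
have [|r rP] := @mem_maximal_inv _ p (\prod_(q <- s) u q) pmax.
  by rewrite prime_mem_prod; apply/hasPn => q /uP[].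
exists (r * \prod_(q <- s) u q) => // q qs; apply: idealMr.
by rewrite prime_mem_prod; apply/hasP; exists q => //; have [] := uP q qs.
Qed.

(** A solution [a] for [s] is corrected at [p] by a multiple of an [e] that is
    [1] modulo [p] and [0] modulo every ideal in [s]. *)
Lemma chinese_remainder_module (R : comNzRingType) (A : lmodType R)
    (s : seq (Spec R)) (c : Spec R -> A) :
  {in s, forall p, maximal_point p} ->
  exists a, {in s, forall p, ideal_multiple A p (a - c p)}.
Proof.
elim: s => [|p s IH] smax; first by exists 0.
have pmax : maximal_point p by apply: smax; rewrite mem_head.
have {}smax : {in s, forall q, maximal_point q}.
  by move=> q qs; apply: smax; rewrite inE qs orbT.
have [a aP] := IH smax.
have [ps|ps] := boolP (p \in s).
  by exists a => q; rewrite inE => /orP[/eqP->|]; exact: aP.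
have [e ep es] := maximal_ideal_avoid smax ps pmax.
exists (a + e *: (c p - a)) => q; rewrite inE => /orP[/eqP->|qs].
  have -> : a + e *: (c p - a) - c p = (e - 1) *: (c p - a).
    by rewrite scalerBl scale1r opprB addrAC [RHS]addrC.
  exact: ideal_multipleZ.
rewrite addrAC; apply: (submodD (ideal_multiple_submod A q)); first exact: aP.
by apply: ideal_multipleZ; exact: es.
Qed.

(** * Deficiency loci *)

Section Deficiency.
Variables (R : comNzRingType) (A : lmodType R) (mul : {bilinear A -> A -> A}).

Lemma generates_mod_trans (p : Spec R) (X Y : set A) :
  X `<=` subalgebra mul (Y `|` ideal_multiple A p) ->
  generates_mod mul p X -> generates_mod mul p Y.
Proof.
move=> XY Xgen; apply/seteqP; split=> // x _.
have : subalgebra mul (X `|` ideal_multiple A p) x by rewrite -/(generates_mod mul p X) Xgen.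
apply: subalgebra_sub => y [/XY//|Iy].
by apply: sub_gen_smallest; right.
Qed.

(** Bounding the number of added elements makes the notion monotone in [j] without
    padding. *)
Definition extendable (p : Spec R) (j : nat) (X : seq A) : Prop :=
  exists2 Y : seq A, (size Y <= j)%N & generates_mod mul p [set` Y ++ X].

Lemma extendable_mono (p : Spec R) (i j : nat) (X Y : seq A) :
  (i <= j)%N -> {subset X <= Y} -> extendable p i X -> extendable p j Y.
Proof.
move=> ij XY [Z Zi Zgen]; exists Z; first exact: leq_trans Zi ij.
apply: generates_mod_trans Zgen => x /=; rewrite mem_cat => xZX.
apply: sub_gen_smallest; left => /=; rewrite mem_cat.
by case/orP: xZX => [->|/XY->]; rewrite ?orbT.
Qed.

(** An element of a smallest completing family works for all [j] at once, and
    only its class modulo [p] matters. *)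
Lemma extendable_cons (p : Spec R) (X : seq A) :
  exists c, forall a, ideal_multiple A p (a - c) ->
    forall j, extendable p j.+1 X -> extendable p j (a :: X).
Proof.
have [ext|Next] := pselect (exists j, extendable p j X); last first.
  by exists 0 => a _ j ext; case: Next; exists j.+1.
have ex_size : exists i, `[< exists2 Y : seq A, size Y = i & generates_mod mul p [set` Y ++ X] >].
  by case: ext => j [Y _ Ygen]; exists (size Y); apply/asboolP; exists Y.
case: (ex_minnP ex_size) => i /asboolP[[|c Y] sY Ygen] imin.
  exists 0 => a _ j _; apply: (extendable_mono (leq0n j) (X := X)).
    by move=> x Xx; rewrite inE Xx orbT.
  by exists [::].
exists c => a ac j [Z Zj Zgen]; exists Y.
  have : (i <= size Z)%N by apply: imin; apply/asboolP; exists Z.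
  by rewrite -sY => /leq_trans/(_ Zj).
apply: generates_mod_trans Ygen => x /=; rewrite inE => /orP[/eqP->|xYX]; last first.
  apply: sub_gen_smallest; left => /=; move: xYX.
  by rewrite !mem_cat inE => /orP[->|->]; rewrite ?orbT.
set B := subalgebra _ _.
have [Bcl _] : nonunital_subalgebra mul B := subalgebra_closed mul _.
rewrite -(subKr a c); apply: (submodB Bcl); apply: sub_gen_smallest; last by right.
by left => /=; rewrite mem_cat inE eqxx orbT.
Qed.

Definition deficient (j : nat) (X : seq A) : set (MaxSpec R) :=
  [set p | ~ extendable (set_val p) j X].

(** It is the zero locus of all the multipliers into the subalgebras generated by
    the completions of [X] by at most [j] elements. *)
Lemma deficient_closed (j : nat) (X : seq A) :
  finitely_generated [set: A] -> closed (deficient j X).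
Proof.
move=> Afg; apply/MaxSpec_closedP.
exists [set s | exists2 Y : seq A, (size Y <= j)%N &
  forall x, subalgebra mul [set` Y ++ X] (s *: x)].
apply/seteqP; split=> p.
  move=> Np s [Y Yj sY]; apply: contrapT => /negP sp; apply: Np; exists Y => //.
  exact: conductor_generates_mod (set_valP p) sp sY.
move=> pS [Y Yj /(generates_mod_conductor Afg)[s sp sY]].
by move/negP: sp; apply; apply: pS; exists Y.
Qed.

Lemma deficient_sub (j : nat) (X : seq A) (a : A) :
  deficient j (a :: X) `<=` deficient j X.
Proof.
move=> p Np ext; apply: Np; apply: extendable_mono ext => // x Xx.
by rewrite inE Xx orbT.
Qed.

(** One further element, chosen by the Chinese remainder theorem at sample
    points of the first [n] deficiency loci, replaces the bound for each of them by
    the bound for the next one.  The hypothesis on [e] says that this asks each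
    dimension to drop by at most one. *)
Lemma dim_lt_deficient_step (n : nat) (X : seq A) (e : nat -> nat) :
  noetherian R -> finitely_generated [set: A] ->
  (forall j, (e j <= (e j.+1).+1)%N) ->
  (forall j, dim_lt (deficient j X) (e j)) ->
  exists a, forall j, (j < n)%N -> dim_lt (deficient j (a :: X)) (e j.+1).
Proof.
move=> Rn Afg ele dimX.
have samp j := dim_lt_sample (MaxSpec_noetherian Rn) (@deficient_closed j X Afg)
  (dim_lt_leq (ele j) (dimX j)) (dimX j.+1).
have [s sP] := choice samp.
have [c cP] := choice (fun p => extendable_cons p X).
pose pts := flatten [seq s j | j <- iota 0 n].
have [|a aP] := @chinese_remainder_module R A [seq (set_val p : Spec R) | p <- pts] c.
  by move=> _ /mapP[p _ ->]; exact: set_valP.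
exists a => j jn; have [sX sdim] := sP j; apply: sdim => [|p ps]; first exact: deficient_sub.
apply; apply: cP.
  apply: aP; apply: map_f; apply/flattenP; exists (s j) => //.
  by apply: map_f; rewrite mem_iota.
by have [_ /contrapT] := sX p ps.
Qed.

End Deficiency.

(** * Counting the generators *)

Theorem theorem1p2 (R : comNzRingType) (d n : nat)
    (A : lmodType R) (mul : {bilinear A -> A -> A})
    (R_noetherian : noetherian R)
    (dim_MaxSpec : has_dimension (MaxSpec R) d)
    (A_fg : finitely_generated [set: A])
    (A_fibers : forall p : Spec R, maximal_point p ->
       generated_by (fiber_mul mul p) n) :
  generated_by mul (n + d).
Proof.
have def0 j X : (n <= j)%N -> deficient mul j X = set0.
  move=> nj; apply/seteqP; split=> // p; apply.
  have pmax : maximal_point (set_val p) := set_valP p.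
  have [Y Yn Ygen] := fiber_generates_mod pmax (A_fibers _ pmax).
  by apply: (extendable_mono nj (X := [::])) => //; exists Y; rewrite ?Yn ?cats0.
have dim0 e : dim_lt (set0 : set (MaxSpec R)) e.
  by move=> k X [/(_ k (leqnn k))[_ [[p Xp] _]] _] /(_ p Xp).
(* A strict bound: the dimension bound after [k] steps is [e k j - 1]. *)
pose e k j := (d.+1 - (j.+1 + k - n))%N.
have dimX k : exists2 X : seq A, size X = k & forall j, dim_lt (deficient mul j X) (e k j).
  elim: k => [|k [X sX Xe]].
    exists [::] => // j; have [nj|jn] := leqP n j; first by rewrite def0.
    move=> k Y Ych _; have [_ /(_ k Y Ych)] := dim_MaxSpec.
    by rewrite /e addn0 (eqP jn) subn0.
  have ele j : (e k j <= (e k j.+1).+1)%N.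
    by rewrite /e; lia.
  have [a aP] := dim_lt_deficient_step n R_noetherian A_fg ele Xe.
  exists (a :: X); first by rewrite /= sX.
  move=> j; have [nj|jn] := leqP n j; first by rewrite def0.
  by rewrite /e addnS; exact: aP.
have [X sX Xe] := dimX (n + d)%N.
have e0 : e (n + d)%N 0%N = 0%N by rewrite /e; lia.
have X0 : deficient mul 0 X = set0.
  apply: dim_lt0; first exact: deficient_closed.
  by have := Xe 0%N; rewrite e0.
exists (fun i : 'I_(n + d) => nth 0 X i).
have -> : range (fun i : 'I_(n + d) => nth 0 X i) = [set` X].
  apply/seteqP; split=> [_ [i _ <-]|x Xx] /=; first by rewrite mem_nth ?sX.
  by move: (Xx); rewrite /= -index_mem sX => xn; exists (Ordinal xn); rewrite //= nth_index.
apply: generates_of_mod => // p pmax.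
have pP : p \in [set q : Spec R | maximal_point q] by rewrite inE.
have : ~ deficient mul 0 X (exist _ p pP) by rewrite X0.
move=> /contrapT[Y]; rewrite leqn0 size_eq0 => /eqP->.
exact.
Qed.
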